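(* Let $\ell \in \mathbb{N}$ be a positive integer and let $\mathcal{A} \subset \mathscr{P}(\mathbb{N}_0)$ be a Furstenberg family. Let $f:X\to X$ be a continuous map on a topological space $X$, and let $\overline{f}:\mathcal{K}(X)\to\mathcal{K}(X)$, $\overline{f}(K):=f(K)$, be the induced map on the hyperspace of non-empty compact subsets of $X$ endowed with the Vietoris topology. Then the following statements are equivalent: (i) $f_{(N)}:X^N\to X^N$ is topologically $(\ell,\mathcal{A})$-recurrent for every $N \in \mathbb{N}$; (ii) $\overline{f}_{(N)}:\mathcal{K}(X)^N\to \mathcal{K}(X)^N$ is topologically $(\ell,\mathcal{A})$-recurrent for every $N \in \mathbb{N}$; (iii) $\overline{f}:\mathcal{K}(X)\to \mathcal{K}(X)$ is topologically $(\ell,\mathcal{A})$-recurrent.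
   Context: $\mathbb{N}$ is the set of strictly positive integers and $\mathbb{N}_0=\mathbb{N}\cup\{0\}$; $\mathscr{P}(\mathbb{N}_0)$ is the power set of $\mathbb{N}_0$. Furstenberg family: a collection $\mathcal{A}\subset\mathscr{P}(\mathbb{N}_0)$ that is hereditarily upward (if $A\in\mathcal{A}$ and $A\subset B\subset\mathbb{N}_0$, then $B\in\mathcal{A}$) and such that $\varnothing\notin\mathcal{A}$. For a continuous self-map $g:Y\to Y$ of a topological space $Y$ and $N\in\mathbb{N}$, $g_{(N)}:Y^N\to Y^N$ denotes the $N$-fold direct product $g_{(N)}(y_1,\dots,y_N)=(g(y_1),\dots,g(y_N))$, where $Y^N$ carries the product topology. Topological $(\ell,\mathcal{A})$-recurrence: a continuous self-map $g:Y\to Y$ of a topological space $Y$ is topologically $(\ell,\mathcal{A})$-recurrent if for every non-empty open subset $U\subset Y$ the set $$\mathcal{N}_g^{\ell}(U):=\left\{ n\in\mathbb{N}_0 \;;\; U\cap g^{-n}(U)\cap g^{-2n}(U)\cap\cdots\cap g^{-\ell n}(U)\neq\varnothing \right\}$$ belongs to $\mathcal{A}$, where $g^{-m}(U)$ is the preimage of $U$ under the $m$-th iterate $g^m$ (with $g^0=\mathrm{id}$). $\mathcal{K}(X)$ is the set of all non-empty compact subsets of $X$. The Vietoris topology on $\mathcal{K}(X)$ is the topology with base formed by the sets $$\mathcal{V}(U_1,\dots,U_N):=\Big\{K\in\mathcal{K}(X)\;;\; K\subset\bigcup_{j=1}^N U_j \text{ and } K\cap U_j\neq\varnothing \text{ for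 all } 1\le j\le N\Big\},$$ where $N\in\mathbb{N}$ and $U_1,\dots,U_N$ are non-empty open subsets of $X$. The map $\overline{f}(K):=f(K)=\{f(x)\;;\;x\in K\}$ is continuous for this topology. *)

(* Defs.v *)
From HB Require Import structures.
From mathcomp Require Import all_boot all_classical.
From mathcomp Require Import topology function_spaces.

Set Implicit Arguments.
Unset Strict Implicit.
Unset Printing Implicit Defensive.

Local Open Scope classical_set_scope.

Definition furstenberg_family (A : set (set nat)) : Prop :=
  (forall B C : set nat, A B -> B `<=` C -> A C) /\ ~ A set0.

(* The term j = 0 of the intersection is U itself. *)
Definition return_set (Y : Type) (g : Y -> Y) (l : nat) (U : set Y) : set nat :=
  [set n | \bigcap_(j in [set j | j <= l]) (iter (j * n) g @^-1` U) !=set0].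

Definition top_recurrent (l : nat) (A : set (set nat)) (Y : topologicalType)
    (g : Y -> Y) : Prop :=
  forall U : set Y, open U -> U !=set0 -> A (return_set g l U).

(* {ptws 'I_N -> Y} is the set of maps 'I_N -> Y with the product topology. *)
Definition prod_map (N : nat) (Y : topologicalType) (g : Y -> Y)
  (y : {ptws 'I_N -> Y}) : {ptws 'I_N -> Y} := fun i => g (y i).
Arguments prod_map N {Y} g y.

Lemma prod_map_continuous N (Y : topologicalType) (g : Y -> Y) :
  continuous g -> continuous (prod_map N g).
Proof.
move=> cg y.
have FF : Filter (prod_map N g @ y).
  by apply: fmap_filter; exact: (@nbhs_filter {ptws 'I_N -> Y} y).
apply/cvg_sup => i V [_ [[W oW <-] /= Wgy]] /filterS; apply.
have : continuous (g \o @proj _ (fun=> Y) i : {ptws 'I_N -> Y} -> Y).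
  move=> z; apply: continuous_comp; last exact: cg.
  exact: proj_continuous.
by move=> /(_ y W); apply; exact: open_nbhs_nbhs.
Qed.

Section Hyperspace.
Variable X : topologicalType.

Record hyperspace : Type := Hyperspace {
  hset :> set X ;
  hset_compact : compact hset ;
  hset_neq0 : hset !=set0 }.

HB.instance Definition _ := gen_eqMixin hyperspace.
HB.instance Definition _ := gen_choiceMixin hyperspace.

Lemma hyperspace_eq (K L : hyperspace) : hset K = hset L -> K = L.
Proof.
case: K L => [K cK K0] [L cL L0] /= KL; case: L / KL cL L0 => cL L0.
by rewrite (Prop_irrelevance cK cL) (Prop_irrelevance K0 L0).
Qed.

Definition vietoris (N : nat) (U : 'I_N -> set X) : set hyperspace :=
  [set K : hyperspace |
    K `<=` \bigcup_j U j /\ forall j, (K : set X) `&` U j !=set0].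

Definition vietoris_base : set (set hyperspace) :=
  [set W | exists (N : nat) (U : 'I_N -> set X),
    [/\ 0 < N, forall j, open (U j), forall j, U j !=set0
      & W = vietoris U]].

Let vietoris_cover : \bigcup_(W in vietoris_base) W = setT.
Proof.
rewrite -subTset => K _; exists (vietoris (fun _ : 'I_1 => [set: X])).
  exists 1, (fun=> setT); split => // => _; first exact: openT.
  by have [x _] := hset_neq0 K; exists x.
split=> [x _|_]; first by exists ord0.
by rewrite setIT; exact: hset_neq0.
Qed.

Let vietoris_join (V W : set hyperspace) (K : hyperspace) :
  vietoris_base V -> vietoris_base W -> V K -> W K ->
  exists Z, [/\ vietoris_base Z, Z K & Z `<=` V `&` W].
Proof.
move=> [m [U [m0 oU _ ->]]] [n [U' [n0 oU' _ ->]]] [KU KUj] [KU' KUj'].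
pose T (k : 'I_(m + n)) := match fintype.split k with
  | inl i => U i `&` \bigcup_j U' j
  | inr j => (\bigcup_i U i) `&` U' j
  end.
have Tl i : T (lshift n i) = U i `&` \bigcup_j U' j.
  by rewrite /T; case: fintype.splitP => [i' /= /val_inj->|j /= E] //;
    have := ltn_ord i; rewrite E ltnNge leq_addr.
have Tr j : T (rshift m j) = (\bigcup_i U i) `&` U' j.
  rewrite /T; case: fintype.splitP => [i /= E|j' /= /addnI/val_inj->] //.
  by have := ltn_ord i; rewrite -E ltnNge leq_addr.
have KT k : (K : set X) `&` T k !=set0.
  rewrite /T; case: (fintype.split k) => i.
    have [x [Kx Ux]] := KUj i; exists x; split=> //; split=> //; exact: KU'.
  have [x [Kx Ux]] := KUj' i; exists x; split=> //; split=> //; exact: KU.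
exists (vietoris T); split.
- exists (m + n), T; split=> //; first by rewrite addn_gt0 m0.
  + move=> k; rewrite /T; case: (fintype.split k) => i; apply: openI => //;
      by apply: bigcup_open => j _.
  + by move=> k; have [x [_ Tx]] := KT k; exists x.
- split=> // x Kx; have [i _ Uix] := KU _ Kx; exists (lshift n i) => //.
  by rewrite Tl; split=> //; exact: KU'.
- move=> L [LT LTk]; split; split.
  + move=> x /LT[k _]; rewrite /T; case: (fintype.split k) => i [] // Uix _.
    by exists i.
  + move=> i; have [x [Lx]] := LTk (lshift n i); rewrite Tl => -[Ux _].
    by exists x.
  + move=> x /LT[k _]; rewrite /T; case: (fintype.split k) => i [] // _ Uix.
    by exists i.
  + move=> j; have [x [Lx]] := LTk (rshift m j); rewrite Tr => -[_ Ux].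
    by exists x.
Qed.

HB.instance Definition _ := isBaseTopological.Build hyperspace
  vietoris_cover vietoris_join.

Lemma open_hyperspaceE (O : set hyperspace) :
  open O <-> forall K, O K ->
    exists W, [/\ vietoris_base W, W K & W `<=` O].
Proof.
split=> [[D sD <-] K [W DW WK]|H].
  by exists W; split=> //; [exact: sD|move=> L WL; exists W].
exists [set W | vietoris_base W /\ W `<=` O]; first by move=> W [].
rewrite eqEsubset; split=> [K [W [_ WO] /WO]//|K /H[W [bW WK WO]]].
by exists W.
Qed.

End Hyperspace.

Definition hyper_map (X : topologicalType) (f : X -> X) (cf : continuous f)
    (K : hyperspace X) : hyperspace X :=
  @Hyperspace X (f @` K)
    (continuous_compact (continuous_subspaceT cf) (@hset_compact X K))
    (image_nonempty f (@hset_neq0 X K)).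

Lemma hyper_map_continuous (X : topologicalType) (f : X -> X)
  (cf : continuous f) : continuous (hyper_map cf).
Proof.
apply/continuousP => O /open_hyperspaceE oO.
apply/open_hyperspaceE => K /oO[_ [[N [U [N0 oU U0 ->]] [fKU fKUj] WO]]].
have Kj j : (K : set X) `&` f @^-1` U j !=set0.
  by have [_ [[x Kx <-] Ufx]] := fKUj j; exists x.
exists (vietoris (fun j => f @^-1` U j)); split.
- exists N, (fun j => f @^-1` U j); split=> // j.
    by apply: open_comp => // x _; exact: cf.
  by have [x [_ ?]] := Kj j; exists x.
- by split=> // x Kx; have [j _ ?] := fKU (f x) (imageP f Kx); exists j.
- move=> L [LU LUj]; apply: WO; split=> [_ [x /LU[j _ Ux] <-]|j].
    by exists j.
  by have [x [Lx Ux]] := LUj j; exists (f x); split=> //; exists x.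
Qed.

(* Main.v *)
(** If an orbit leads from a point of [U] to [V] in [m] steps, then every return
    time of [U `&` f^-m V] is a return time of both [U] and [V].  Merging pairs
    in this way, the common return times of finitely many open sets contain
    those of a finite family in which no orbit leads from one member to
    another.  For such a family [U], a compact set returning to [vietoris U]
    meets every [U i], and its points in [U i] can only return to [U i]. *)

Require Import Defs.
From mathcomp Require Import all_boot all_classical.
From mathcomp Require Import topology function_spaces.

Local Open Scope classical_set_scope.

Lemma return_setS (Y : Type) (g : Y -> Y) (l : nat) (U V : set Y) :
  U `<=` V -> return_set g l U `<=` return_set g l V.
Proof. by move=> UV n [x Ux]; exists x => j jl; apply/UV/Ux. Qed.

(** A point [x] returning to the intersection serves for [U], and [iter m g x] serves for [V],
    because iterates of [g] commute. *)
Lemma return_set_meet (Y : Type) (g : Y -> Y) (l m : nat) (U V : set Y) :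
  return_set g l (U `&` iter m g @^-1` V) `<=`
  return_set g l U `&` return_set g l V.
Proof.
move=> n [x UVx]; split; first by exists x => j /UVx[].
by exists (iter m g x) => j /UVx[_] /=; rewrite -!iterD addnC.
Qed.

Lemma iter_prod_map (N : nat) (Y : topologicalType) (g : Y -> Y) (k : nat)
    (y : {ptws 'I_N -> Y}) (i : 'I_N) :
  iter k (prod_map N g) y i = iter k g (y i).
Proof. by elim: k => //= k <-. Qed.

Lemma open_box (N : nat) (Y : topologicalType) (V : 'I_N -> set Y) :
  (forall i, open (V i)) ->
  open [set y : {ptws 'I_N -> Y} | forall i, V i (y i)].
Proof.
move=> oV; rewrite openE => y Vy.
(* Finiteness of ['I_N] reduces the claim to one coordinate at a time. *)
apply: (@filter_forall _ _ _ _ (@nbhs_filter {ptws 'I_N -> Y} y)) => i.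
have := @proj_continuous _ (fun=> Y) i y (V i).
by apply; apply: open_nbhs_nbhs; split; [exact: oV|exact: Vy].
Qed.

(** The sets containing an open box around [y] form a filter. It converges to [y], since convergence
    in the product topology is tested on each coordinate, so it contains [W]. *)
Lemma open_subbox (N : nat) (Y : topologicalType) (W : set {ptws 'I_N -> Y})
    (y : {ptws 'I_N -> Y}) : open W -> W y ->
  exists V : 'I_N -> set Y, [/\ forall i, open (V i), forall i, V i (y i)
    & [set z | forall i, V i (z i)] `<=` W].
Proof.
move=> oW Wy.
pose F : set_system {ptws 'I_N -> Y} := [set S | exists V : 'I_N -> set Y,
  [/\ forall i, open (V i), forall i, V i (y i)
    & [set z | forall i, V i (z i)] `<=` S]].
have FF : Filter F.
  split.
  - by exists (fun=> setT); split=> // i; exact: openT.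
  - move=> S T [V [oV Vy VS]] [V' [oV' V'y V'T]].
    exists (fun i => V i `&` V' i); split=> [i|i|z Vz].
    + exact: openI.
    + by split.
    + by split; [apply: VS|apply: V'T] => i; have [] := Vz i.
  - move=> S T ST [V [oV Vy VS]]; exists V; split=> //.
    exact: subset_trans ST.
have Fy : F --> y.
  apply/cvg_sup => i S [_ [[V oV <-] /= Vy]] /filterS; apply.
  exists (fun k => if k == i then V else setT); split=> [k|k|z].
  - by case: ifP => // _; exact: openT.
  - by case: eqP => [->|].
  - by move=> /(_ i); rewrite eqxx.
by apply: Fy; exact: open_nbhs_nbhs.
Qed.

(** The return times of a box are the common return times of its sides. Every non-empty open set
    contains a non-empty open box, and [A] is closed upward. *)
Lemma top_recurrent_prodP (l : nat) (A : set (set nat)) (N : nat)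
    (Y : topologicalType) (g : Y -> Y) :
  furstenberg_family A ->
  top_recurrent l A (prod_map N g) <->
  forall V : 'I_N -> set Y, (forall i, open (V i)) ->
    (forall i, V i !=set0) -> A (\bigcap_i return_set g l (V i)).
Proof.
move=> [Aup _]; split=> [gA V oV V0|gA W oW [y Wy]].
  apply: Aup _ _ (gA _ (open_box _ _ _ oV) _) _.
    by have /choice[y Vy] := V0; exists y.
  move=> n [y Vy] i _; exists (y i) => j /Vy /= /(_ i).
  by rewrite iter_prod_map.
have [V [oV Vy VW]] := open_subbox _ _ _ _ oW Wy.
apply: Aup _ _ (gA V oV _) _ => [i|n Vn]; first by exists (y i).
have /choice[x Vx] : forall i, exists x, forall j, j <= l ->
    V i (iter (j * n) g x).
  by move=> i; have [x Vx] := Vn i I; exists x.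
exists x => j jl; apply: VW => i /=.
by rewrite iter_prod_map; exact: Vx.
Qed.

Section HyperspaceRecurrence.
Variables (X : topologicalType) (f : X -> X) (cf : continuous f).

Lemma open_vietoris (N : nat) (U : 'I_N -> set X) : 0 < N ->
  (forall i, open (U i)) -> open (vietoris U).
Proof.
move=> N0 oU; apply/open_hyperspaceE => K KU; exists (vietoris U); split=> //.
by exists N, U; split=> // i; have [x [_ Ux]] := KU.2 i; exists x.
Qed.

(** Finite sets are compact; this is the source of all explicit members of [vietoris U]. *)
Lemma vietoris_range (N : nat) (U : 'I_N -> set X) (x : 'I_N -> X) : 0 < N ->
  (forall i, U i (x i)) ->
  exists2 K : hyperspace X, vietoris U K & hset K = range x.
Proof.
move=> N0 Ux.
have cK : compact (range x) by apply: finite_compact; exact: finite_image.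
have K0 : range x !=set0 by exists (x (Ordinal N0)); exists (Ordinal N0).
exists (Hyperspace cK K0) => //; split=> [_ [i _ <-]|i]; first by exists i.
by exists (x i); split=> //; exists i.
Qed.

Lemma hset_iter_hyper_map (k : nat) (K : hyperspace X) :
  hset (iter k (hyper_map cf) K) = iter k f @` K.
Proof.
elim: k => [|k IHk]; first by rewrite image_id.
by rewrite iterS /= IHk image_comp.
Qed.

(** Choosing one returning point in each [U i] gives a finite set that returns to [vietoris U]. *)
Lemma return_set_vietoris (l N : nat) (U : 'I_N -> set X) : 0 < N ->
  \bigcap_i return_set f l (U i) `<=`
  return_set (hyper_map cf) l (vietoris U).
Proof.
move=> N0 n Un.
have /choice[x Ux] : forall i, exists x, forall j, j <= l ->
    U i (iter (j * n) f x).
  by move=> i; have [x Ux] := Un i I; exists x.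
have [|K _ Kx] := @vietoris_range N U x N0.
  by move=> i; exact: (Ux i 0).
exists K => j jl; rewrite /preimage /= /vietoris /= hset_iter_hyper_map Kx.
split=> [_ [_ [i _ <-] <-]|i]; first by exists i => //; exact: Ux.
by exists (iter (j * n) f (x i)); split; [exists (x i) => //; exists i|exact: Ux].
Qed.

Lemma continuous_iter (m : nat) : continuous (iter m f).
Proof.
elim: m => [|m IHm] x; first exact: cvg_id.
by apply: (@continuous_comp _ _ _ (iter m f) f); [exact: IHm|exact: cf].
Qed.

Lemma return_set_vietoris_separated (l N : nat) (U : 'I_N -> set X) :
  (forall i k m, U i `&` iter m f @^-1` U k !=set0 -> i = k) ->
  return_set (hyper_map cf) l (vietoris U) `<=`
  \bigcap_i return_set f l (U i).
Proof.
move=> sepU n [K KU] i _.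
(* The term [j = 0] says that [K] itself lies in [vietoris U], hence meets [U i]. *)
have [x [Kx Ux]] := (KU 0 (leq0n l)).2 i.
exists x => j jl; have [+ _] := KU j jl; rewrite hset_iter_hyper_map.
move=> /(_ _ (imageP (iter (j * n) f) Kx))[k _ Uk].
by rewrite /preimage /= {1}(sepU i k (j * n))//; exists x.
Qed.

Lemma return_set_hyper_map (l N : nat) (U : 'I_N.+1 -> set X) :
  (forall i, open (U i)) -> (forall i, U i !=set0) ->
  exists O : set (hyperspace X), [/\ open O, O !=set0
    & return_set (hyper_map cf) l O `<=` \bigcap_i return_set f l (U i)].
Proof.
(* Induction on the number of sets. When no orbit links two different members, [O] is [vietoris U],
   in the base case and in the inductive step alike. *)
move: U; elim: N => [|N IHN] U oU U0;
  have [sepU|] := pselect (forall i k m,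
    U i `&` iter m f @^-1` U k !=set0 -> i = k);
  try by (exists (vietoris U); split;
    [exact: open_vietoris| |exact: return_set_vietoris_separated];
    have /choice[x Ux] := U0; have [//|K KU _] := vietoris_range _ _ x _ Ux;
    exists K).
(* A single set is always separated: ['I_1] has only one index. *)
- by case=> i k m _; rewrite (ord1 i) (ord1 k).
- move=> /existsNP[i /existsNP[k /existsNP[m /not_implyP[Uikm /eqP ik]]]].
  (* [lift k] skips the index [k], so [V] has one set fewer; the merged set replaces [U i], whose
     index survives because [i] differs from [k]. *)
  pose V a := if lift k a == i then U i `&` iter m f @^-1` U k
              else U (lift k a).
  have [a|a|O [oO O0 OV]] := IHN V.
  + rewrite /V; case: ifP => // _; apply: openI => //.
    apply: open_comp => // x _; exact: continuous_iter.
  + by rewrite /V; case: ifP.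
  + exists O; split=> // n /OV Vn.
    have [a ia _] : {a | i = lift k a & unlift k i = Some a}.
      by apply: unlift_some; rewrite eq_sym.
    have := Vn a I; rewrite /V -ia eqxx => /return_set_meet[Ui Uk] b _.
    have [c ->|->//] := unliftP k b.
    by have := Vn c I; rewrite /V; case: eqP => // ->.
Qed.

End HyperspaceRecurrence.

Theorem theorem3p1 (l : nat) (hl : 0 < l) (A : set (set nat))
    (hA : furstenberg_family A) (X : topologicalType) (f : X -> X)
    (cf : continuous f) :
  [<-> forall N : nat, 0 < N -> top_recurrent l A (prod_map N f);
       forall N : nat, 0 < N -> top_recurrent l A (prod_map N (hyper_map cf));
       top_recurrent l A (hyper_map cf)].
Proof.
have [Aup _] := hA.
tfae => [fA N N0|fA|fA [//|N] _].
- apply/(top_recurrent_prodP _ _ _ _ _ hA) => V oV V0.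
  (* Each [V i] is shrunk to a basic Vietoris set, given by a finite family [B i] of open sets of
     [X]. *)
  have /choice[B BV] : forall i, exists B : {n & 'I_n -> set X},
      [/\ 0 < tag B, forall j, open (tagged B j),
        forall j, tagged B j !=set0 & vietoris (tagged B) `<=` V i].
    move=> i; have [K VK] := V0 i; have /open_hyperspaceE/(_ K VK) := oV i.
    move=> [_ [[n [U [n0 oU U0 ->]]] _ UV]].
    by exists (Tagged (fun n => 'I_n -> set X) U).
  (* The families [B i] are listed together as a single family [W], so that recurrence of one
     product of copies of [f] handles them all at once. *)
  pose T := {i : 'I_N & 'I_(tag (B i))}.
  pose W (t : 'I_#|{: T}|) :=
    tagged (B (tag (enum_val t))) (tagged (enum_val t)).
  have WA : A (\bigcap_t return_set f l (W t)).
    have T0 : 0 < #|{: T}|.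
      apply/card_gt0P; pose i := Ordinal N0.
      have [ni _ _ _] := BV i.
      by exists (Tagged (fun i => 'I_(tag (B i))) (Ordinal ni)).
    apply: ((top_recurrent_prodP _ _ _ _ _ hA).1 (fA _ T0)) => t;
      have [_ oB B0 _] := BV (tag (enum_val t)); [exact: oB|exact: B0].
  apply: Aup _ _ WA _ => k Wk i _; have [ni _ _ BVi] := BV i.
  apply: (return_setS _ _ _ _ _ BVi).
  apply: return_set_vietoris => // j _.
  have := Wk (enum_rank (Tagged (fun i => 'I_(tag (B i))) j)) I.
  by rewrite /W enum_rankK.
- move=> U oU U0.
  have := (top_recurrent_prodP l A 1 _ _ hA).1 (fA 1 isT) (fun=> U).
  move=> /(_ (fun=> oU) (fun=> U0)) /Aup; apply.
  by move=> n /(_ ord0 I).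
(* The return times of the single open set [O] of compact sets are common return times of all the
   [V i]. *)
- apply/(top_recurrent_prodP _ _ _ _ _ hA) => V oV V0.
  have [O [oO O0 OV]] := return_set_hyper_map X f cf l N V oV V0.
  exact: Aup _ _ (fA O oO O0) OV.
Qed.
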